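(* There exists an absolute constant $C > 0$ such that the following holds. Let $R$ be a ring with identity, and let $A \subset R$ be finite and non-empty. Suppose that $|A \cdot A - A \cdot A| \leq K |A|$ and $|A \cdot A| \geq |A|/K$ for some $K \geq 1$. Suppose also that $A$ contains an invertible element $a$. Then at least one of the following holds: (i) ($A-A$ has many zero divisors) $|(A-A) \setminus R^*| \geq C^{-1} K^{-C} |A|$; or (ii) (Subring structure) there exists a finite subring $S$ of $R$ such that $A \subset a\cdot S = S\cdot a$ and $|S| \leq C K^C |A|$.
   Context: Rings are associative and need not be commutative; a subring is an additive subgroup closed under multiplication (it is not required to contain the identity). For subsets $A,B$ of a ring $R$: $A-B := \{a-b : a \in A, b\in B\}$, $A\cdot B := \{ab : a\in A, b\in B\}$; for $r \in R$, $r\cdot A := \{ra : a\in A\}$ and $A\cdot r := \{ar : a \in A\}$. $|A|$ denotes the cardinality of a finite set $A$. $R^*$ denotes the set of non-zero-divisors of $R$, i.e. the elements $r \in R$ such that $ra \neq 0$ and $ar \neq 0$ whenever $a \in R$, $a \neq 0$. *)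

(* Defs.v *)
From HB Require Import structures.
From mathcomp Require Import all_boot all_order all_algebra finmap.
From mathcomp Require Import all_classical all_reals all_analysis.

Set Implicit Arguments.
Unset Strict Implicit.
Unset Printing Implicit Defensive.

Import Order.TTheory GRing.Theory Num.Theory.

Local Open Scope ring_scope.
Local Open Scope fset_scope.

(* [pzRingType] is used rather than [nzRingType] so that the zero ring is not
   excluded; [unitRingType] is avoided for the same reason. *)

Definition diffset (R : pzRingType) (A B : {fset R}) : {fset R} :=
  [fset a - b | a in A, b in B].

Definition prodset (R : pzRingType) (A B : {fset R}) : {fset R} :=
  [fset a * b | a in A, b in B].

Definition ldilate (R : pzRingType) (r : R) (A : {fset R}) : {fset R} :=
  [fset r * a | a in A].

Definition rdilate (R : pzRingType) (A : {fset R}) (r : R) : {fset R} :=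
  [fset a * r | a in A].

Definition non_zero_divisor (R : pzRingType) (r : R) : Prop :=
  forall a : R, a != 0 -> r * a != 0 /\ a * r != 0.

(* The elements of [A] outside R^*. *)
Definition zero_divisors_in (R : pzRingType) (A : {fset R}) : {fset R} :=
  [fset r in A | `[< ~ non_zero_divisor r >]].

Definition invertible (R : pzRingType) (a : R) : Prop :=
  exists b : R, b * a = 1 /\ a * b = 1.

(* [1 \in S] is not required. *)
Definition is_subring (R : pzRingType) (S : {fset R}) : Prop :=
  GRing.zmod_closed (mem S) /\ GRing.mulr_2closed (mem S).

(* Main.v *)
(* Normalise to B = a^-1 A, which contains 1, and write s(x) = a^-1 x a and
   D = s(B)B, so that |D - D| <= K|B|. By Pluennecke's inequality (Petridis's
   argument) and Ruzsa's covering lemma, the sets B - B, s(B) - s(B) and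
   2D - 2D are each covered by K^O(1) translates of W = B - B. Call r an
   L-multiplier if r W is covered by L translates of W. Multipliers are closed
   under subtraction, multiplication and s up to a polynomial loss in L, and
   all of B consists of multipliers. If B - B has few zero divisors, then by
   pigeonhole every L-multiplier r with L = K^O(1) satisfies r d = e for many
   d in B - B outside the zero divisors and e in W + W. This bounds the number
   of L-multipliers by K^O(1)|B|, and it also shows that r is an L0-multiplier
   for a fixed L0 = K^O(1) independent of L. So the L0-multipliers are exactly
   closed, and they form the required subring. *)
Require Import Defs.
From mathcomp Require Import all_boot all_order all_algebra finmap.
From mathcomp Require Import all_classical all_reals all_analysis.
From mathcomp Require Import ring lra.

Set Implicit Arguments.
Unset Strict Implicit.
Unset Printing Implicit Defensive.

Import Order.TTheory GRing.Theory Num.Theory.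

Local Open Scope ring_scope.
Local Open Scope fset_scope.

(** * Sumsets and double counting in finite sets *)

Definition sumset (V : zmodType) (A B : {fset V}) : {fset V} :=
  [fset (x + y)%R | x in A, y in B].

Definition oppset (V : zmodType) (A : {fset V}) : {fset V} :=
  [fset (- x)%R | x in A].

Lemma leq_card_imfset (T U : choiceType) (f : T -> U) (A : {fset T}) :
  (#|` [fset f x | x in A]| <= #|` A|)%N.
Proof.
rewrite -(size_map f); apply: uniq_leq_size; first exact: fset_uniq.
by move=> _ /imfsetP[x xA ->]; apply: map_f.
Qed.

Lemma card_inj_imfset (T U : choiceType) (f : T -> U) (A : {fset T}) :
  injective f -> #|` [fset f x | x in A]| = #|` A|.
Proof. by move=> fI; rewrite card_imfset. Qed.

(** Both sides count the pairs [(t, p)] in [S] times [P] with [g p = t]. *)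
Lemma sum_card_fibers (T U : choiceType) (g : U -> T) (S : {fset T})
    (P : {fset U}) :
  (\sum_(t <- S) #|` [fset p in P | g p == t]| = #|` [fset p in P | g p \in S]|)%N.
Proof.
under eq_bigr do rewrite card_fset_sum1 -big_fset_condE /=.
rewrite card_fset_sum1 -big_fset_condE /=.
under eq_bigr do rewrite big_mkcond.
rewrite exchange_big /= [RHS]big_mkcond; apply: eq_bigr => p _.
case: ifP => [gpS|gpS]; last first.
  rewrite big1_seq // => t /andP[_ tS]; case: eqP => // gp.
  by rewrite -gp gpS in tS.
rewrite (big_fsetD1 (g p)) //= eqxx big1_seq // => t /andP[_].
by rewrite !inE eq_sym => /andP[/negbTE -> _].
Qed.

(** * Algebra of sumsets and Pluennecke's inequality *)

Section Sumsets.
Local Open Scope ring_scope.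
Variable V : zmodType.
Implicit Types (A B C X : {fset V}) (x y : V).

Lemma mem_sumset A B x y : x \in A -> y \in B -> x + y \in sumset A B.
Proof. by move=> xA yB; apply: in_imfset2. Qed.

Lemma sumsetP A B z :
  reflect (exists2 x, x \in A & exists2 y, y \in B & z = x + y)
          (z \in sumset A B).
Proof. exact: imfset2P. Qed.

Lemma mem_oppset A x : (x \in oppset A) = (- x \in A).
Proof.
apply/imfsetP/idP => [[y yA ->]|xA]; first by rewrite opprK.
by exists (- x) => //; rewrite opprK.
Qed.

Lemma sumsetC A B : sumset A B = sumset B A.
Proof.
by apply/fsetP => z; apply/sumsetP/sumsetP => -[x xA [y yB ->]];
  exists y => //; exists x => //; rewrite addrC.
Qed.

Lemma sumsetA A B C : sumset A (sumset B C) = sumset (sumset A B) C.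
Proof.
apply/fsetP => z; apply/sumsetP/sumsetP.
- move=> [x xA [_ /sumsetP[y yB [t tC ->]] ->]].
  by exists (x + y); [exact: mem_sumset|exists t => //; rewrite addrA].
- move=> [_ /sumsetP[x xA [y yB ->]] [t tC ->]].
  by exists x => //; exists (y + t); [exact: mem_sumset|rewrite addrA].
Qed.

Lemma sumsetCA A B C : sumset A (sumset B C) = sumset B (sumset A C).
Proof. by rewrite !sumsetA (sumsetC A). Qed.

Lemma sumsetACA A B C X :
  sumset (sumset A B) (sumset C X) = sumset (sumset A C) (sumset B X).
Proof. by rewrite -!sumsetA (sumsetCA B). Qed.

Lemma sumsetS A A' B B' :
  A `<=` A' -> B `<=` B' -> sumset A B `<=` sumset A' B'.
Proof.
move=> /fsubsetP sA /fsubsetP sB; apply/fsubsetP => _ /sumsetP[x xA [y yB ->]].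
by apply: mem_sumset; [apply: sA|apply: sB].
Qed.

Lemma oppsetS A B : A `<=` B -> oppset A `<=` oppset B.
Proof.
by move=> /fsubsetP sAB; apply/fsubsetP => x; rewrite !mem_oppset; apply: sAB.
Qed.

Lemma oppsetK A : oppset (oppset A) = A.
Proof. by apply/fsetP => x; rewrite !mem_oppset opprK. Qed.

Lemma oppsetD A B : oppset (sumset A B) = sumset (oppset A) (oppset B).
Proof.
apply/fsetP => z; rewrite mem_oppset; apply/sumsetP/sumsetP.
- move=> [x xA [y yB e]]; exists (- x); first by rewrite mem_oppset opprK.
  by exists (- y); rewrite ?mem_oppset ?opprK // -opprD -e opprK.
- move=> [x xA [y yB e]]; exists (- x); first by rewrite -mem_oppset.
  by exists (- y); rewrite -?mem_oppset // -opprD e.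
Qed.

Lemma card_oppset A : #|` oppset A| = #|` A|.
Proof. exact/card_inj_imfset/oppr_inj. Qed.

Lemma sumset0 A : sumset A fset0 = fset0.
Proof. by apply/fsetP => z; rewrite in_fset0; apply/sumsetP => -[x _ []]. Qed.

Lemma leq_card_sumset A B : (#|` sumset A B| <= #|` A| * #|` B|)%N.
Proof.
rewrite -(size_allpairs +%R); apply: uniq_leq_size; first exact: fset_uniq.
by move=> _ /sumsetP[x xA [y yB ->]]; apply: allpairs_f.
Qed.

Lemma card_translate A x : #|` sumset A [fset x]| = #|` A|.
Proof.
have -> : sumset A [fset x] = [fset y + x | y in A].
  apply/fsetP => z; apply/sumsetP/imfsetP => /=.
    by move=> [y yA [_ /fset1P -> ->]]; exists y.
  by move=> [y yA ->]; exists y => //; exists x => //; rewrite fset11.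
exact/card_inj_imfset/addIr.
Qed.

Lemma leq_card_sumsetl A B : B != fset0 -> (#|` A| <= #|` sumset A B|)%N.
Proof.
move=> /fset0Pn[b bB]; rewrite -(card_translate A b).
by apply/fsubset_leq_card/sumsetS => //; rewrite fsub1set.
Qed.

(* Petridis's form of the Pluennecke inequality: adding [C] does not increase
   the growth factor of a set [X] which is least expanded by [B]. *)
Lemma petridis X B C :
  (forall Y, Y `<=` X -> (#|` sumset X B| * #|` Y| <= #|` sumset Y B| * #|` X|)%N) ->
  (#|` sumset (sumset X B) C| * #|` X| <= #|` sumset X B| * #|` sumset X C|)%N.
Proof.
move=> minX; elim/finSet_rect: C => C IH.
have [->|/fset0Pn[c cC]] := eqVneq C fset0.
  by rewrite sumset0 cardfs0.
have {}IH := IH _ (fproperD1 cC).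
set C' := C `\ c in IH.
have defC : C = c |` C' by rewrite fsetD1K.
(* For [y] in [Y] the set [y + B + c] is already in [X + B + C'], so [c] contributes at most
   [|X + B| - |Y + B|] new elements. If [x + c] lies in [X + C'], then [x + B + c] lies in
   [X + B + C'], so [x] is in [Y]; hence [X + C] exceeds [X + C'] by at least [|X| - |Y|]. *)
pose Y := [fset y in X | sumset (sumset [fset y] B) [fset c] `<=` sumset (sumset X B) C'].
have YX : Y `<=` X by apply/fsubsetP => y; rewrite !inE => /andP[].
have sub1 : sumset (sumset X B) C `<=` sumset (sumset X B) C'
    `|` (sumset (sumset X B) [fset c] `\` sumset (sumset Y B) [fset c]).
  apply/fsubsetP => _ /sumsetP[s sXB [t tC ->]]; rewrite inE.
  case: (boolP (s + t \in _)) => //= nin.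
  move: tC; rewrite defC => /fset1UP[etc|tC']; last first.
    by rewrite mem_sumset in nin.
  rewrite etc in nin *; rewrite in_fsetD (mem_sumset sXB (fset11 c)) andbT.
  apply: contra nin => /sumsetP[_ /sumsetP[y yY [b bB ->]] [_ /fset1P -> ->]].
  move: yY; rewrite !inE => /andP[_ /fsubsetP]; apply.
  by rewrite !mem_sumset ?fset11.
have sub2 : sumset X C' `|` (sumset X [fset c] `\` sumset Y [fset c])
     `<=` sumset X C.
  apply/fsubsetP => z; rewrite !inE => /orP[|/andP[_]].
    by apply/fsubsetP/sumsetS; rewrite ?fsubset_refl // defC fsubsetUr.
  by apply/fsubsetP/sumsetS; rewrite ?fsubset_refl // defC fsubsetUl.
have dis : sumset X C' `&` (sumset X [fset c] `\` sumset Y [fset c]) = fset0.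
  apply/fsetP => z; rewrite !inE; apply/negP => /and3P[zXC' zY].
  move=> /sumsetP[x xX [_ /fset1P -> ez]]; case/negP: zY.
  rewrite ez mem_sumset ?fset11 // !inE xX /=.
  apply/fsubsetP => _ /sumsetP[_ /sumsetP[_ /fset1P -> [b bB ->]] [_ /fset1P -> ->]].
  move: zXC'; rewrite ez => /sumsetP[x' x'X [t tC' e]].
  rewrite addrAC e addrAC; by rewrite !mem_sumset.
have c1 : (#|` sumset (sumset X B) C| <= #|` sumset (sumset X B) C'| +
    (#|` sumset X B| - #|` sumset Y B|))%N.
  apply: leq_trans (fsubset_leq_card sub1) _; rewrite cardfsU.
  apply: leq_trans (leq_subr _ _) _; rewrite leq_add2l cardfsDS ?card_translate //.
  by do 2!apply: sumsetS => //.
have c2 : (#|` sumset X C'| + (#|` X| - #|` Y|) <= #|` sumset X C|)%N.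
  apply: leq_trans (fsubset_leq_card sub2).
  rewrite cardfsU dis cardfs0 subn0 leq_add2l cardfsDS ?card_translate //.
  exact: sumsetS.
apply: leq_trans (leq_mul c1 (leqnn _)) _.
apply: leq_trans _ (leq_mul (leqnn _) c2).
(* The two increments compare by the minimality of [X], tested on [Y]. *)
rewrite mulnDl mulnDr; apply: leq_add => //.
by rewrite mulnBl mulnBr leq_sub2l // minX.
Qed.

(** [X] minimises the ratio [|X + B| / |X|] over the non-empty subsets of [A]. *)
Lemma exists_least_expanded A B : A != fset0 ->
  exists X, [/\ X `<=` A, X != fset0 &
   forall Y, Y `<=` A -> (#|` sumset X B| * #|` Y| <= #|` sumset Y B| * #|` X|)%N].
Proof.
move=> A0.
pose F (X : fpowerset A) : rat :=
  #|` sumset (val X) B|%:R / #|` val X|%:R.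
have AA : A \in fpowerset A by rewrite fpowersetE.
pose i0 : fpowerset A := [` AA].
have Pi0 : [pred X : fpowerset A | val X != fset0] i0 by [].
case: (Order.TotalTheory.arg_minP
  (P := [pred X : fpowerset A | val X != fset0]) F Pi0) => X X0 minX.
have XA : val X `<=` A by rewrite -fpowersetE; apply: valP.
exists (val X); split => // Y YA.
have [->|Y0] := eqVneq Y fset0; first by rewrite cardfs0 muln0.
have YP : Y \in fpowerset A by rewrite fpowersetE.
have := minX [` YP] Y0; rewrite /F /=.
rewrite ler_pdivrMr ?ltr0n ?cardfs_gt0 // mulrAC ler_pdivlMr ?ltr0n ?cardfs_gt0 //.
by rewrite -!natrM ler_nat.
Qed.

Fixpoint nfold (n : nat) A : {fset V} :=
  if n is m.+1 then sumset A (nfold m A) else [fset 0].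

Lemma sumset_zero A : sumset A [fset 0] = A.
Proof.
apply/fsetP => z; apply/sumsetP/idP => [[x xA [_ /fset1P -> ->]]|zA].
  by rewrite addr0.
by exists z => //; exists 0; rewrite ?fset11 ?addr0.
Qed.

Lemma nfold_sub1 A B n : A `<=` B -> sumset A (nfold n B) `<=` nfold n.+1 B.
Proof. by move=> AB; apply: sumsetS. Qed.

Variable F : realFieldType.
Implicit Types (K L M : F).

(** Let [X] in [A] be least expanded by [-A]. By [petridis], each summand [-A] added to [X + C]
    costs a factor [K]. With [C = m A] this bounds [X - n A + m A]; with [C = 0] it bounds [k A] by
    [K ^ k |X|]. *)
Lemma plunnecke A K m n : A != fset0 -> 1 <= K ->
  #|` sumset A (oppset A)|%:R <= K * #|` A|%:R ->
  #|` sumset (nfold m A) (oppset (nfold n A))|%:R <= K ^+ (m + n).+1 * #|` A|%:R.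
Proof.
move=> A0 K1 hA; have K0 : 0 <= K by apply: le_trans K1.
have [X [XA X0 minX]] := exists_least_expanded (oppset A) A0.
have Xp : 0 < #|` X|%:R :> F by rewrite ltr0n cardfs_gt0.
have Ap : 0 < #|` A|%:R :> F by rewrite ltr0n cardfs_gt0.
have hX : #|` sumset X (oppset A)|%:R <= K * #|` X|%:R.
  rewrite -(ler_pM2r Ap); have := minX A (fsubset_refl _).
  rewrite -(ler_nat F) !natrM => /le_trans; apply.
  by rewrite mulrAC ler_wpM2r // ltW.
have step C : #|` sumset (sumset X (oppset A)) C|%:R <= K * #|` sumset X C|%:R.
  rewrite -(ler_pM2r Xp) mulrAC.
  have := @petridis X (oppset A) C
     (fun Y YX => minX Y (fsubset_trans YX XA)).
  rewrite -(ler_nat F) !natrM => /le_trans; apply.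
  by rewrite ler_wpM2r.
have steps k C : #|` sumset (sumset X (oppset (nfold k A))) C|%:R
    <= K ^+ k * #|` sumset X C|%:R.
  elim: k C => [|k IH] C.
    have -> : oppset (nfold 0 A) = [fset 0].
      by apply/fsetP => z; rewrite mem_oppset !inE oppr_eq0.
    by rewrite sumset_zero expr0 mul1r.
  rewrite /= oppsetD -sumsetA -[sumset (sumset _ _) C]sumsetA sumsetA.
  apply: le_trans (step _) _; rewrite exprS -mulrA ler_wpM2l // sumsetA.
  exact: IH.
have hm k : #|` nfold k A|%:R <= K ^+ k * #|` X|%:R.
  have := steps k [fset 0]; rewrite !sumset_zero; apply: le_trans.
  by rewrite -card_oppset ler_nat sumsetC leq_card_sumsetl.
apply: (@le_trans _ _ #|` sumset (sumset X (oppset (nfold n A))) (nfold m A)|%:R).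
  by rewrite ler_nat -sumsetA [sumset X _]sumsetC (sumsetC (oppset _)) leq_card_sumsetl.
apply: le_trans (steps _ _) _; rewrite -addSn addnC exprD -mulrA.
rewrite ler_wpM2l ?exprn_ge0 //.
(* [X] lies in [A], so [X + m A] lies in [(m + 1) A]: hence the extra 1 in the exponent. *)
apply: (@le_trans _ _ #|` nfold m.+1 A|%:R).
  by rewrite ler_nat; apply/fsubset_leq_card/sumsetS.
apply: le_trans (hm _) _; rewrite ler_wpM2l ?exprn_ge0 //.
by rewrite ler_nat fsubset_leq_card.
Qed.
End Sumsets.

Lemma card_pigeonhole (T U : choiceType) (g : U -> T) (S : {fset T})
    (P : {fset U}) : P != fset0 -> {in P, forall p, g p \in S} ->
  exists2 t, t \in S & (#|` P| <= #|` S| * #|` [fset p in P | g p == t]|)%N.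
Proof.
move=> P0 gS; apply: contrapT => H.
have lt t : t \in S ->
    (#|` S| * #|` [fset p in P | g p == t]| < #|` P|)%N.
  by move=> tS; rewrite ltnNge; apply/negP => ?; apply: H; exists t.
have e : [fset p in P | g p \in S] = P.
  by apply/fsetP => p; rewrite !inE andb_idr //; apply: gS.
have := sum_card_fibers g S P; rewrite e => {}e.
(* Summing the strict bounds over [S] gives [|S| |P| + |S| <= |S| |P|], so [S] would be empty. *)
have : (\sum_(t <- S) (#|` S| * #|` [fset p in P | g p == t]|).+1
        <= \sum_(t <- S) #|` P|)%N.
  rewrite big_seq [X in (_ <= X)%N]big_seq; apply: leq_sum => t tS; exact: lt.
under eq_bigr do rewrite -addn1.
rewrite big_split /= -big_distrr /= e -card_fset_sum1.
rewrite big_const_seq count_predT iter_addn_0 mulnC -[leqRHS]addn0 leq_add2l.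
rewrite leqn0 cardfs_eq0 => /eqP S0; case/fset0Pn: P0 => p /gS.
by rewrite S0 in_fset0.
Qed.

(** * Covering by translates and Ruzsa's covering lemma *)

Section Covering.
Local Open Scope ring_scope.
Variables (V : zmodType) (F : realFieldType).
Implicit Types (P Q T X : {fset V}) (L M : F).

Definition cov L P Q : Prop :=
  exists2 X : {fset V}, #|` X|%:R <= L & P `<=` sumset X Q.

Lemma cov_le L M P Q : L <= M -> cov L P Q -> cov M P Q.
Proof. by move=> LM [X XL PX]; exists X => //; apply: le_trans LM. Qed.

Lemma cov_sub L P P' Q : P' `<=` P -> cov L P Q -> cov L P' Q.
Proof. by move=> PP [X XL PX]; exists X => //; apply: fsubset_trans PX. Qed.

Lemma cov_subr L P Q Q' : Q `<=` Q' -> cov L P Q -> cov L P Q'.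
Proof.
move=> QQ [X XL PX]; exists X => //; apply: fsubset_trans PX _.
exact: sumsetS.
Qed.

Lemma card_sumset_le X Y L M : #|` X|%:R <= L -> #|` Y|%:R <= M ->
  #|` sumset X Y : {fset V}|%:R <= L * M.
Proof.
move=> XL YM; apply: (@le_trans _ _ (#|` X| * #|` Y|)%:R).
  by rewrite ler_nat leq_card_sumset.
by rewrite natrM ler_pM.
Qed.

Lemma cov_trans L M P Q T : cov L P Q -> cov M Q T -> cov (L * M) P T.
Proof.
move=> [X XL PX] [Y YM QY]; exists (sumset X Y); first exact: card_sumset_le.
by apply: fsubset_trans PX _; rewrite -sumsetA; apply: sumsetS.
Qed.

Lemma cov_sum L M P P' Q Q' :
  cov L P Q -> cov M P' Q' -> cov (L * M) (sumset P P') (sumset Q Q').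
Proof.
move=> [X XL PX] [Y YM QY]; exists (sumset X Y); first exact: card_sumset_le.
by rewrite sumsetACA; apply: sumsetS.
Qed.

Lemma cov_opp L P Q : cov L P Q -> cov L (oppset P) (oppset Q).
Proof.
move=> [X XL PX]; exists (oppset X); first by rewrite card_oppset.
by rewrite -oppsetD; apply: oppsetS.
Qed.

Lemma cov_card L P Q : cov L P Q -> #|` P|%:R <= L * #|` Q|%:R.
Proof.
move=> [X XL PX]; apply: (@le_trans _ _ #|` sumset X Q|%:R); last exact: card_sumset_le.
by rewrite ler_nat fsubset_leq_card.
Qed.

Lemma cov_img L P Q (f : V -> V) : {morph f : x y / x + y} ->
  cov L P Q -> cov L [fset f x | x in P] [fset f x | x in Q].
Proof.
move=> fD [X XL /fsubsetP PX]; exists [fset f x | x in X].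
  by apply: le_trans XL; rewrite ler_nat leq_card_imfset.
apply/fsubsetP => _ /imfsetP[p /= pP ->].
have /sumsetP[x xX [q qQ ->]] := PX p pP.
by rewrite fD mem_sumset //; apply: in_imfset.
Qed.

(** Enlarge [X] inside [Q] while the translates [P + x] stay disjoint, which is recorded as
    [|P + X| = |P| |X|]. When this stops, every [P + q] meets [P + X], so [q] lies in [X + P - P];
    disjointness inside [P + Q] gives [|X| <= L]. *)
Lemma ruzsa_covering L P Q : P != fset0 ->
  #|` sumset P Q|%:R <= L * #|` P|%:R -> cov L Q (sumset P (oppset P)).
Proof.
move=> P0 hPQ.
suff H X : X `<=` Q -> #|` sumset P X| = (#|` P| * #|` X|)%N ->
    exists Y, [/\ Y `<=` Q, #|` sumset P Y| = (#|` P| * #|` Y|)%N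
      & Q `<=` sumset Y (sumset P (oppset P))].
  have [||Y [YQ cY QY]] := H fset0; rewrite ?fsub0set ?sumset0 ?cardfs0 ?muln0 //.
  exists Y => //; rewrite -(@ler_pM2l _ #|` P|%:R) ?ltr0n ?cardfs_gt0 //.
  rewrite -natrM -cY mulrC; apply: le_trans hPQ.
  by rewrite ler_nat; apply/fsubset_leq_card/sumsetS.
move=> XQ; move: {1}(XQ); move: X XQ; apply: fset_bounded_coind => X IH XQ cX.
have [QX|] := boolP (Q `<=` sumset X (sumset P (oppset P))); first by exists X.
move=> /fsubsetPn[q qQ qX].
have dis : sumset P X `&` sumset P [fset q] = fset0.
  apply/fsetP => z; rewrite in_fset0 in_fsetI; apply/negP => /andP[].
  move=> /sumsetP[p pP [x xX ->]] /sumsetP[p' p'P [_ /fset1P -> e]].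
  case/negP: qX; have -> : q = x + (p + - p').
    by rewrite addrCA addrA e addrAC subrr add0r.
  by rewrite !mem_sumset // mem_oppset opprK.
have qnX : q \notin X.
  apply: contra qX => qX; case/fset0Pn: P0 => p pP.
  rewrite -[q]addr0 mem_sumset // -(subrr p) mem_sumset //.
  by rewrite mem_oppset opprK.
have YQ : q |` X `<=` Q.
  by apply/fsubsetP => x /fset1UP[->//|]; apply/fsubsetP.
apply: (IH (q |` X)) => //.
  by rewrite fproperEcard fsubsetUr cardfsU1 qnX add1n ltnSn.
have -> : sumset P (q |` X) = sumset P X `|` sumset P [fset q].
  apply/fsetP => z; rewrite in_fsetU; apply/sumsetP/orP.
  - move=> [p pP [x /fset1UP[->|xX] ->]]; last by left; rewrite mem_sumset.
    by right; rewrite mem_sumset ?fset11.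
  - case=> /sumsetP[p pP [x xX ->]]; exists p => //; exists x => //.
      by rewrite !inE xX orbT.
    by rewrite in_fsetU xX.
by rewrite cardfsU dis cardfs0 subn0 card_translate cX cardfsU1 qnX mulnDr muln1 addnC.
Qed.

End Covering.

(** * Multipliers and their loss under ring operations *)

Section Multipliers.
Local Open Scope ring_scope.
Variables (R : pzRingType) (F : realFieldType).
Implicit Types (B W : {fset R}) (r s d e : R) (k L M : F).

Lemma diffsetE (A B : {fset R}) : diffset A B = sumset A (oppset B).
Proof.
apply/fsetP => z; apply/imfset2P/sumsetP => /=.
- move=> [x xA [y yB ->]]; exists x => //; exists (- y) => //.
  by rewrite mem_oppset opprK.
- move=> [x xA [y]]; rewrite mem_oppset => yB ->; exists x => //.
  by exists (- y) => //; rewrite opprK.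
Qed.

Definition mulcov L W r : Prop := cov L (ldilate r W) W.

Lemma mem_ldilate r W x : x \in W -> r * x \in ldilate r W.
Proof. exact: in_imfset. Qed.

Lemma cov_ldilate L (P Q : {fset R}) r :
  cov L P Q -> cov L (ldilate r P) (ldilate r Q).
Proof. by apply: cov_img => x y; rewrite mulrDr. Qed.

Lemma mulcovM L M W r s :
  mulcov L W r -> mulcov M W s -> mulcov (M * L) W (r * s).
Proof.
move=> hr hs; apply: cov_trans hr; apply: cov_sub (cov_ldilate r hs).
apply/fsubsetP => _ /imfsetP[x /= xW ->]; rewrite -mulrA.
by do 2!apply: mem_ldilate.
Qed.

(** Since [W] is symmetric, [r W - s W] is covered by [L M] translates of [W + W]; the factor [k]
    returns to [W]. *)
Lemma mulcovB k L M W r s : oppset W = W -> cov k (sumset W W) W ->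
  mulcov L W r -> mulcov M W s -> mulcov (L * M * k) W (r - s).
Proof.
move=> oW hW hr hs; apply: cov_trans hW; rewrite -{3}oW.
apply: cov_sub (cov_sum hr (cov_opp hs)).
apply/fsubsetP => _ /imfsetP[x /= xW ->]; rewrite mulrBl.
by apply: mem_sumset; rewrite ?mem_oppset ?opprK mem_ldilate.
Qed.

(** As [d] is not a zero divisor, [|d W| = |W|], and Ruzsa's lemma covers [W] by [L k] translates of
    [d W - d W]. Multiplying by [r] covers [r W] by translates of [r d W - r d W], which is
    controlled through [r d]. *)
Lemma mulcov_quotient k L M W r d : W != fset0 ->
  oppset W = W -> cov k (sumset W W) W -> non_zero_divisor d ->
  mulcov L W d -> mulcov M W (r * d) -> mulcov (L * k * (M * M) * k) W r.
Proof.
move=> W0 oW hW nzd hd he.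
have dI : injective ( *%R d).
  move=> x y exy; apply/eqP; rewrite -subr_eq0; apply/negPn/negP => /nzd[].
  by rewrite mulrBr exy subrr eqxx.
have c1 : cov (L * k) W (sumset (ldilate d W) (oppset (ldilate d W))).
  apply: ruzsa_covering.
    by case/fset0Pn: W0 => w wW; apply/fset0Pn; exists (d * w); apply: mem_ldilate.
  rewrite /ldilate card_inj_imfset //.
  have hWW : cov (1 : F) W W.
    exists [fset 0]; rewrite ?cardfs1 // sumsetC sumset_zero //.
  have := cov_card (cov_trans (cov_sum hd hWW) hW).
  by rewrite mulr1.
have c2 : cov (M * M) (sumset (ldilate (r * d) W) (oppset (ldilate (r * d) W)))
    (sumset W W).
  by rewrite -{4}oW; apply: cov_sum he (cov_opp he).
apply: cov_trans hW; apply: cov_trans c2.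
have := cov_ldilate r c1; apply: cov_subr.
apply/fsubsetP => _ /imfsetP[_ /= /sumsetP[x xW [y yW ->]] ->].
rewrite mulrDr mem_sumset //.
  by case/imfsetP: xW => z /= zW ->; rewrite mulrA mem_ldilate.
move: yW; rewrite !mem_oppset -mulrN => /imfsetP[z /= zW ->].
by rewrite mulrA mem_ldilate.
Qed.
End Multipliers.

Lemma leq_card_fsetM (T U : choiceType) (A : {fset T}) (B : {fset U}) :
  (#|` A `*` B| <= #|` A| * #|` B|)%N.
Proof.
rewrite -(size_allpairs pair); apply: uniq_leq_size; first exact: fset_uniq.
by move=> [x y]; rewrite in_fsetM => /andP[xA yB]; apply: allpairs_f.
Qed.

(** * Multipliers as quotients, their number, and the subring *)

Section Quotients.
Local Open Scope ring_scope.
Variables (R : pzRingType) (F : realFieldType).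
Implicit Types (B W S D : {fset R}) (r s d e : R) (k L M : F).

Lemma non_zero_divisor_cancel d r s : non_zero_divisor d -> r * d = s * d -> r = s.
Proof.
move=> nzd e; apply/eqP; rewrite -subr_eq0; apply/negPn/negP => /nzd[_].
by rewrite mulrBl e subrr eqxx.
Qed.

(** The quotient of [p.2] by [p.1] on the right, unique when [p.1] is not a zero divisor; 0 if there
    is none. *)
Definition quotient (p : R * R) : R := xget 0 [set r | r * p.1 = p.2]%classic.

Lemma quotientK d r : non_zero_divisor d -> quotient (d, r * d) = r.
Proof.
move=> nzd; apply: (non_zero_divisor_cancel nzd).
have : exists r', [set r' | r' * d = r * d]%classic r' by exists r.
exact: xgetPex.
Qed.

(** Among the [L] translates of [W] covering [r W], one contains [r (b - b0)] for at least [|B| / L]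
    elements [b]. Differences of two such [b] are sent by [r] into [W - W = W + W]. Discarding zero
    divisors loses at most half of the bound. *)
Lemma many_quotients B L r : B != fset0 ->
  let W := sumset B (oppset B) in
  mulcov L W r -> 2 * L * #|` zero_divisors_in W|%:R <= #|` B|%:R ->
  exists D, [/\ D `<=` W, {in D, forall d, non_zero_divisor d},
    {in D, forall d, r * d \in sumset W W} & #|` B|%:R <= 2 * L * #|` D|%:R].
Proof.
move=> B0 W [X XL rWX] hZ.
have L0 : 0 <= L by apply: le_trans XL.
have oW : oppset W = W by rewrite oppsetD oppsetK sumsetC.
case/fset0Pn: (B0) => b0 b0B.
have BW b b' : b \in B -> b' \in B -> b - b' \in W.
  by move=> bB b'B; rewrite mem_sumset // mem_oppset opprK.
(* [g b] is the centre of a translate of [W] containing [r (b - b0)]. *)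
pose g b := xget 0 [set x | x \in X /\ r * (b - b0) - x \in W]%classic.
have gP b : b \in B -> g b \in X /\ r * (b - b0) - g b \in W.
  move=> bB; have : exists x, [set x | x \in X /\ r * (b - b0) - x \in W]%classic x.
    have /(fsubsetP rWX)/sumsetP[x xX [w wW e]] := mem_ldilate r (BW _ _ bB b0B).
    by exists x; split => //; rewrite e addrAC subrr add0r.
  exact: xgetPex.
have [b /gP[]//|x xX cB] := card_pigeonhole (S := X) (g := g) B0.
set E := [fset b in B | g b == x] in cB.
have cBE : #|` B|%:R <= L * #|` E|%:R.
  apply: (@le_trans _ _ (#|` X| * #|` E|)%:R); first by rewrite ler_nat.
  by rewrite natrM ler_wpM2r.
have /fset0Pn[b1 b1E] : E != fset0.
  apply: contraNneq B0 => E0; rewrite -cardfs_eq0 -leqn0.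
  by apply: leq_trans cB _; rewrite E0 cardfs0 muln0.
have EP b : b \in E -> b \in B /\ g b = x.
  by rewrite !inE => /andP[-> /eqP ->].
pose D0 := sumset E [fset - b1].
have D0W : D0 `<=` W.
  by apply/fsubsetP => _ /sumsetP[b /EP[bB _] [_ /fset1P -> ->]];
    apply: BW => //; case: (EP _ b1E).
exists (D0 `\` zero_divisors_in W); split.
- by apply: fsubset_trans D0W; rewrite fsubsetDl.
- move=> d; rewrite in_fsetD => /andP[dZ /(fsubsetP D0W) dW].
  apply: contrapT => nd; case/negP: dZ; rewrite !inE dW /=.
  exact/asboolP.
- move=> d; rewrite in_fsetD => /andP[_ /sumsetP[b /EP[bB gb] [_ /fset1P -> ->]]].
  have [b1B gb1] := EP _ b1E.
  have -> : r * (b - b1) = (r * (b - b0) - x) + - (r * (b1 - b0) - x).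
    by rewrite opprB addrA subrK -mulrBr opprB addrA subrK.
  apply: mem_sumset; first by rewrite -gb; case: (gP b bB).
  by rewrite -mem_oppset oW -gb1; case: (gP b1 b1B).
- have : (#|` E|)%:R <= #|` zero_divisors_in W|%:R
      + #|` D0 `\` zero_divisors_in W|%:R :> F.
    rewrite -(card_translate E (- b1)) -natrD ler_nat.
    rewrite -/D0 -(cardfsID (zero_divisors_in W) D0) leq_add2r.
    exact/fsubset_leq_card/fsubsetIr.
  move=> /(ler_wpM2l L0); rewrite mulrDr; lra.
Qed.

(** Each [r] in [S] is the quotient of at least [|B| / (2 L)] pairs in [W] times [W + W], and
    distinct [r] have disjoint fibres. *)
Lemma card_mulcov B L S : B != fset0 -> 0 <= L ->
  let W := sumset B (oppset B) in
  {in S, forall r, mulcov L W r} ->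
  2 * L * #|` zero_divisors_in W|%:R <= #|` B|%:R ->
  #|` S|%:R * #|` B|%:R <= 2 * L * (#|` W|%:R * #|` sumset W W|%:R).
Proof.
move=> B0 L0 W hS hZ.
pose T := W `*` sumset W W.
have fib r : r \in S ->
    #|` B|%:R <= 2 * L * #|` [fset p in T | quotient p == r]|%:R.
  move=> /hS/many_quotients-/(_ B0 hZ)[D [DW nzD rD]] /le_trans; apply.
  rewrite ler_wpM2l ?mulr_ge0 // ler_nat.
  rewrite -(card_inj_imfset (f := fun d => (d, r * d)) D); last by move=> x y [].
  apply/fsubset_leq_card/fsubsetP => _ /imfsetP[d /= dD ->].
  by rewrite !inE /= (fsubsetP DW) // rD // quotientK ?eqxx //; apply: nzD.
have := sum_card_fibers quotient S T => e.
apply: (@le_trans _ _ (2 * L * (\sum_(r <- S) #|` [fset p in T | quotient p == r]|)%N%:R)).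
  rewrite natr_sum mulr_sumr card_fset_sum1 natr_sum mulr_suml.
  by rewrite big_seq [leRHS]big_seq; apply: ler_sum => r /fib; rewrite mul1r.
rewrite ler_wpM2l ?mulr_ge0 // e -natrM ler_nat.
apply: leq_trans (leq_card_fsetM _ _).
by apply/fsubset_leq_card/fsubsetP => p; rewrite !inE => /andP[].
Qed.

(* A multiplier with a crude covering constant [M] is a quotient of two
   elements obtained from [B], which brings its constant back to [k ^+ 39].
   The multipliers with constant [k ^+ 39] are therefore exactly closed. *)
Lemma mulcov_gap k B M r : B != fset0 -> 1 <= k ->
  let W := sumset B (oppset B) in
  cov k (sumset W W) W -> {in B, forall b, mulcov (k ^+ 3) W b} ->
  2 * M * #|` zero_divisors_in W|%:R <= #|` B|%:R ->
  mulcov M W r -> mulcov (k ^+ 39) W r.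
Proof.
move=> B0 k1 W hW hB hZ hr.
have oW : oppset W = W by rewrite oppsetD oppsetK sumsetC.
have W0 : W != fset0.
  by case/fset0Pn: B0 => b bB; apply/fset0Pn; exists (b + - b);
    rewrite mem_sumset // mem_oppset opprK.
have hd d : d \in W -> mulcov (k ^+ 7) W d.
  move=> /sumsetP[b bB [c]]; rewrite mem_oppset => cB ->.
  rewrite -(opprK c) (_ : k ^+ 7 = k ^+ 3 * k ^+ 3 * k); last by ring.
  by apply: mulcovB => //; apply: hB.
have he e : e \in sumset W W -> mulcov (k ^+ 15) W e.
  move=> /sumsetP[b bW [c cW ->]].
  rewrite -(opprK c) (_ : k ^+ 15 = k ^+ 7 * k ^+ 7 * k); last by ring.
  by apply: mulcovB => //; apply: hd; rewrite // -mem_oppset oW.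
have [D [DW nzD rD cD]] := many_quotients B0 hr hZ.
have /fset0Pn[d dD] : D != fset0.
  apply: contraNneq B0 => D0; rewrite -cardfs_eq0 -leqn0 -(ler_nat F).
  by move: cD; rewrite D0 cardfs0 mulr0.
rewrite (_ : k ^+ 39 = k ^+ 7 * k * (k ^+ 15 * k ^+ 15) * k); last by ring.
apply: mulcov_quotient (nzD _ dD) _ _ => //.
  exact/hd/(fsubsetP DW).
exact/he/rD.
Qed.

(** [S] is the set of multipliers with constant [k ^+ 39]: each closure operation raises the
    constant to at most [k ^+ 79], and [mulcov_gap] brings it back. *)
Lemma subring_of_multipliers k (a a' : R) B : a' * a = 1 -> a * a' = 1 ->
  B != fset0 -> 1 <= k ->
  let W := sumset B (oppset B) in
  let sW := [fset a' * w * a | w in W] in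
  cov k (sumset W W) W -> cov k sW W -> cov k W sW ->
  {in B, forall b, mulcov k W (a' * b * a)} ->
  #|` W|%:R <= k * #|` B|%:R ->
  2 * k ^+ 79 * #|` zero_divisors_in W|%:R <= #|` B|%:R ->
  exists S, [/\ is_subring S, B `<=` S,
    {in S, forall s, a' * s * a \in S}, {in S, forall s, a * s * a' \in S} &
    #|` S|%:R <= 2 * k ^+ 42 * #|` B|%:R].
Proof.
move=> a'a aa' B0 k1 W sW hW hsW hWs hm cW hZ.
have k0 : 0 <= k by apply: le_trans k1.
pose tau x := a * x * a'.
have tauD : {morph tau : x y / x + y} by move=> x y; rewrite /tau mulrDr mulrDl.
pose sg x := a' * x * a.
have sgD : {morph sg : x y / x + y} by move=> x y; rewrite /sg mulrDr mulrDl.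
have sgK x : tau (sg x) = x.
  by rewrite /tau /sg !mulrA aa' mul1r -mulrA aa' mulr1.
have tauK x : sg (tau x) = x.
  by rewrite /tau /sg !mulrA a'a mul1r -mulrA a'a mulr1.
have sgM x y : sg (x * y) = sg x * sg y.
  by rewrite /sg !mulrA -[a' * x * a * a']mulrA aa' mulr1.
have tauM x y : tau (x * y) = tau x * tau y.
  by rewrite /tau !mulrA -[a * x * a' * a]mulrA a'a mulr1.
pose tW := [fset tau w | w in W].
have tsW : [fset tau w | w in sW] = W.
  apply/fsetP => z; apply/imfsetP/idP => /=.
    by move=> [_ /imfsetP[w /= wW ->] ->]; rewrite -/(sg w) sgK.
  by move=> zW; exists (sg z); rewrite ?sgK //; apply: in_imfset.
have hWt : cov k W tW by have := cov_img tauD hsW; rewrite tsW.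
have htW : cov k tW W by have := cov_img tauD hWs; rewrite tsW.
(* Cover [W] by translates of [sW], use [sg r * sg w = sg (r * w)] to cover by [sW] again, then
   return to [W]. *)
have hsg L r : mulcov L W r -> mulcov (k * L * k) W (sg r).
  move=> hr; apply: cov_trans hsW; apply: cov_trans (cov_ldilate (sg r) hWs) _.
  apply: cov_sub (cov_img sgD hr);
  apply/fsubsetP => _ /imfsetP[_ /= /imfsetP[w /= wW ->] ->].
  by rewrite -/(sg w) -sgM in_imfset //=; apply: mem_ldilate.
have htau L r : mulcov L W r -> mulcov (k * L * k) W (tau r).
  move=> hr; apply: cov_trans htW; apply: cov_trans (cov_ldilate (tau r) hWt) _.
  apply: cov_sub (cov_img tauD hr);
  apply/fsubsetP => _ /imfsetP[_ /= /imfsetP[w /= wW ->] ->].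
  by rewrite -tauM in_imfset //=; apply: mem_ldilate.
have hB : {in B, forall b, mulcov (k ^+ 3) W b}.
  move=> b /hm/htau; rewrite -/(sg b) sgK.
  by rewrite (_ : k ^+ 3 = k * k * k) //; ring.
have oW : oppset W = W by rewrite oppsetD oppsetK sumsetC.
(* Subtraction costs the most, 79 = 39 + 39 + 1; products need 78 and conjugations 41. *)
have up M r : M <= k ^+ 79 -> mulcov M W r -> mulcov (k ^+ 39) W r.
  by move=> /cov_le le /le; apply: mulcov_gap hZ.
have hZ39 : 2 * k ^+ 39 * #|` zero_divisors_in W|%:R <= #|` B|%:R.
  apply: le_trans hZ; rewrite ler_wpM2r // ler_wpM2l //.
  exact: ler_weXn2l.
(* A finite set containing every multiplier, by [many_quotients], so that cutting [S] out of it
   loses none. *)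
pose G := [fset quotient p | p in W `*` sumset W W].
pose S := [fset r in G | `[< mulcov (k ^+ 39) W r >]].
have SP r : reflect (mulcov (k ^+ 39) W r) (r \in S).
  apply: (iffP idP) => [|hr]; first by rewrite !inE => /andP[_ /asboolP].
  rewrite in_fset inE /=; apply/andP; split; last exact/asboolP.
  have [D [DW nzD rD cD]] := many_quotients B0 hr hZ39.
  have /fset0Pn[d dD] : D != fset0.
    apply: contraNneq B0 => D0; rewrite -cardfs_eq0 -leqn0 -(ler_nat F).
    by move: cD; rewrite D0 cardfs0 mulr0.
  apply/imfsetP; exists (d, r * d); last by rewrite quotientK //; apply: nzD.
  by rewrite /= in_fsetM /= (fsubsetP DW) // rD.
have subS r s : r \in S -> s \in S -> r - s \in S.
  move=> /SP hr /SP hs; apply/SP.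
  by apply: up (mulcovB oW hW hr hs); rewrite -exprD -exprSr.
have BS : B `<=` S.
  apply/fsubsetP => b /hB hb; apply/SP; apply: up hb; exact: ler_weXn2l.
exists S; split => //.
- split; last first.
    move=> r s /SP hr /SP hs; apply/SP; apply: up (mulcovM hr hs).
    by rewrite -exprD; apply: ler_weXn2l.
  split; last exact: subS.
  by case/fset0Pn: B0 => b /(fsubsetP BS) bS; rewrite -(subrr b); apply: subS.
- move=> r /SP hr; apply/SP; apply: up (hsg _ _ hr).
  by rewrite -exprS -exprSr; apply: ler_weXn2l.
- move=> r /SP hr; apply/SP; apply: up (htau _ _ hr).
  by rewrite -exprS -exprSr; apply: ler_weXn2l.
- have Bp : 0 < #|` B|%:R :> F by rewrite ltr0n cardfs_gt0.
  rewrite -(ler_pM2r Bp).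
  apply: le_trans (card_mulcov B0 (exprn_ge0 39 k0) _ hZ39) _; first by move=> r /SP.
  (* The exponent 42 is 39 from the count, 1 from [|W|] and 2 from [|W + W|]. *)
  have c2 : #|` sumset W W|%:R <= k * (k * #|` B|%:R).
    by apply: le_trans (cov_card hW) _; rewrite ler_wpM2l.
  rewrite (_ : 2 * k ^+ 42 * _ * _ =
    2 * k ^+ 39 * ((k * #|` B|%:R) * (k * (k * #|` B|%:R)))); last by ring.
  by rewrite ler_wpM2l ?mulr_ge0 ?exprn_ge0 // ler_pM.
Qed.
End Quotients.

(** * The normalised case and the reduction to it *)

(** Every set to be covered lies in [E = 2D - 2D], which takes [K ^+ 7] translates of [B - B] or of
    [sB - sB]. So [k = K ^+ 7] in [subring_of_multipliers], with 553 = 7 * 79 and 294 = 7 * 42. *)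
Lemma subring_of_small_products (R : pzRingType) (F : realFieldType) (K : F)
    (a a' : R) (B : {fset R}) :
  a' * a = 1 -> a * a' = 1 -> 1%R \in B -> 1 <= K ->
  let D := prodset [fset a' * b * a | b in B] B in
  #|` diffset D D|%:R <= K * #|` B|%:R ->
  2 * K ^+ 553 * #|` zero_divisors_in (diffset B B)|%:R <= #|` B|%:R ->
  exists S, [/\ is_subring S, B `<=` S,
    {in S, forall s, a' * s * a \in S}, {in S, forall s, a * s * a' \in S} &
    #|` S|%:R <= 2 * K ^+ 294 * #|` B|%:R].
Proof.
move=> a'a aa' B1 K1 D; rewrite !diffsetE => hD hZ.
have K0 : 0 <= K by apply: le_trans K1.
pose sg x := a' * x * a.
pose sB := [fset sg b | b in B].
have sgD : {morph sg : x y / (x + y)%R} by move=> x y; rewrite /sg mulrDr mulrDl.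
have sgN x : sg (- x) = - sg x by rewrite /sg mulrN mulNr.
have sg1 : sg 1 = 1 by rewrite /sg mulr1.
have sgI : injective sg.
  apply: (can_inj (g := fun x => a * x * a')) => x.
  by rewrite /sg !mulrA aa' mul1r -mulrA aa' mulr1.
have B0 : B != fset0 by apply/fset0Pn; exists 1.
have sB1 : 1%R \in sB by rewrite -sg1; apply: in_imfset.
have BD : B `<=` D.
  by apply/fsubsetP => b bB; apply/imfset2P; exists 1 => //; exists b; rewrite ?mul1r.
have sBD : sB `<=` D.
  by apply/fsubsetP => b bB; apply/imfset2P; exists b => //; exists 1; rewrite ?mulr1.
have D0 : D != fset0 by apply/fset0Pn; exists 1; apply: (fsubsetP BD).
pose D2 := nfold 2 D.
pose E := sumset D2 (oppset D2).
have E_ x y z t : x \in D -> y \in D -> z \in D -> t \in D ->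
    (x - y + (z - t))%R \in E.
  move=> xD yD zD tD; rewrite addrACA -opprD.
  rewrite mem_sumset ?mem_oppset ?opprK //= -/D2.
  1,2: by rewrite -[X in (_ + X)%R]addr0 !mem_sumset ?fset11.
(* [P + E] lies in [3D - 2D], of size at most [K ^+ 6 * |D|] by [plunnecke], and
   [|D| <= |D - D| <= K * |B|]. *)
have cE P : P `<=` D -> #|` P| = #|` B| -> cov (K ^+ 7) E (sumset P (oppset P)).
  move=> PD cP; apply: ruzsa_covering.
    by rewrite -cardfs_eq0 cP cardfs_eq0.
  apply: (@le_trans _ _ #|` sumset (nfold 3 D) (oppset (nfold 2 D))|%:R).
    rewrite ler_nat /E sumsetA; apply/fsubset_leq_card/sumsetS => //.
    exact: nfold_sub1.
  apply: le_trans (plunnecke 3 2 D0 K1 _) _.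
    apply: le_trans hD _; rewrite ler_wpM2l // ler_nat.
    exact: fsubset_leq_card.
  rewrite cP (exprSr K 6) -mulrA ler_wpM2l ?exprn_ge0 //.
  apply: le_trans hD; rewrite ler_nat leq_card_sumsetl //.
  by rewrite -cardfs_eq0 card_oppset cardfs_eq0.
pose W := sumset B (oppset B).
pose sW := [fset a' * w * a | w in W].
have sWE : sW = sumset sB (oppset sB).
  apply/fsetP => z; apply/imfsetP/sumsetP => /=.
  - move=> [_ /sumsetP[b bB [c cB ->]] ->]; rewrite -/(sg _) sgD.
    exists (sg b); first exact: in_imfset.
    exists (sg c) => //; rewrite mem_oppset -sgN in_imfset //=.
    by rewrite -mem_oppset.
  - move=> [x /imfsetP[b /= bB ->] [y]]; rewrite mem_oppset.
    move=> /imfsetP[c /= cB ey] ->; exists (b - c).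
      by rewrite mem_sumset // mem_oppset opprK.
    by rewrite -/(sg _) sgD sgN -ey opprK.
have WE P : P `<=` D -> sumset P (oppset P) `<=` E.
  move=> /fsubsetP PD; apply/fsubsetP => z /sumsetP[x xP [y]].
  rewrite mem_oppset => yP ->.
  (* Adding [1 - 1] puts an element of [D - D] into [2D - 2D]. *)
  rewrite -[(x + y)%R]addr0 -(subrr 1) -[y]opprK.
  by apply: E_; [apply: PD|apply: PD|apply: (fsubsetP BD)|apply: (fsubsetP BD)].
have csB : #|` sB| = #|` B| by rewrite /sB card_inj_imfset.
have K7 : 1 <= K ^+ 7 by rewrite exprn_ege1.
have [||||||S [rS BS s1 s2 cS]] :=
  @subring_of_multipliers R F (K ^+ 7) a a' B a'a aa' B0 K7.
- apply: cov_sub (cE _ BD erefl); apply/fsubsetP => u /sumsetP[v /sumsetP[x xB [y yB ->]]].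
  move=> [w /sumsetP[z zB [t tB ->]] ->]; rewrite -[y]opprK -[t]opprK.
  by rewrite !mem_oppset in yB tB; apply: E_; apply: (fsubsetP BD).
- by rewrite -/W -/sW sWE; apply: cov_sub (cE _ BD erefl); apply: WE.
- by rewrite -/W -/sW sWE; apply: cov_sub (cE _ sBD csB); apply: WE.
(* [D] is built for this: [sg b] maps [B] into [D], hence [W] into [D - D]. *)
- move=> b bB; apply: cov_sub (cE _ BD erefl);
  apply/fsubsetP => z /imfsetP[w /= /sumsetP[x xB [y]]].
  rewrite mem_oppset => yB -> ->; rewrite mulrDr -[(_ + _)%R]addr0 -(subrr 1).
  rewrite -[y]opprK mulrN.
  by apply: E_; [apply: in_imfset2 => //=; apply: in_imfset
    |apply: in_imfset2 => //=; apply: in_imfset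
    |exact: (fsubsetP BD)|exact: (fsubsetP BD)].
- apply: (@le_trans _ _ #|` sumset D (oppset D)|%:R).
    by rewrite ler_nat; apply/fsubset_leq_card/sumsetS; rewrite ?oppsetS.
  by apply: le_trans hD _; rewrite ler_wpM2r // -[leLHS]expr1 ler_weXn2l.
- by rewrite -exprM.
by exists S; split => //; rewrite -exprM in cS.
Qed.

Theorem theorem1p5 (RR : realType) :
  exists C : RR, 0 < C /\
    forall (R : pzRingType) (A : {fset R}) (K : RR) (a : R),
      A != fset0 ->
      1 <= K ->
      #|` diffset (prodset A A) (prodset A A)|%:R <= K * #|` A|%:R ->
      #|` A|%:R / K <= #|` prodset A A|%:R ->
      a \in A ->
      invertible a ->
      C^-1 * K `^ (- C) * #|` A|%:R <= #|` zero_divisors_in (diffset A A)|%:R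
      \/
      exists S : {fset R},
        [/\ is_subring S,
            A `<=` ldilate a S,
            ldilate a S = rdilate S a &
            #|` S|%:R <= C * K `^ C * #|` A|%:R].
Proof.
(* Abstracting the exponents prevents unification from unfolding the powers. *)
have [n n2 n553] : exists2 n, (2 <= n)%N & (553 <= n)%N by exists 553%N.
have n0 : (0 < n)%N by apply: leq_trans n2.
exists n%:R; split; first by rewrite ltr0n.
move=> R A K a A0 K1 hA _ aA [a' [a'a aa']].
have K0 : 0 <= K by apply: le_trans K1.
have Kp : 0 < K by apply: lt_le_trans K1.
rewrite powRN powR_mulrn //.
have [?|hZ] := leP (n%:R^-1 * (K ^+ n)^-1 * #|` A|%:R)
  (#|` zero_divisors_in (diffset A A)|%:R : RR); [by left|right].
have aI : injective ( *%R a).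
  by apply: (can_inj (g := *%R a')) => x; rewrite mulrA a'a mul1r.
have a'I : injective ( *%R a').
  by apply: (can_inj (g := *%R a)) => x; rewrite mulrA aa' mul1r.
pose B := ldilate a' A.
have cB : #|` B| = #|` A| by rewrite /B /ldilate card_inj_imfset.
have B1 : 1%R \in B by rewrite -a'a; apply: mem_ldilate.
have BA b : b \in B -> a * b \in A.
  by move=> /imfsetP[x /= xA ->]; rewrite mulrA aa' mul1r.
have [||S [rS BS s1 s2 cS]] := @subring_of_small_products R RR K a a' B a'a aa' B1 K1.
(* The injection [x -> a a x] maps [D - D] into [A A - A A], because
   [a a (a' b a) c = (a b) (a c)]. *)
- set D := prodset _ _; rewrite cB; apply: le_trans hA; rewrite ler_nat.
  rewrite -(card_inj_imfset (diffset D D) (f := fun x => a * (a * x))); last first.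
    by move=> x y /aI/aI.
  apply/fsubset_leq_card/fsubsetP => _ /imfsetP[_ /= /imfset2P[x /= xD [y /= yD ->]] ->].
  have DA x' : x' \in D -> a * (a * x') \in prodset A A.
    move=> /imfset2P[_ /= /imfsetP[b /= bB ->] [c /= cB' ->]].
    rewrite !mulrA -[a * a * a']mulrA aa' mulr1 -[a * b * a * c]mulrA.
    by apply: in_imfset2; apply: BA.
  by rewrite !mulrBr; apply: in_imfset2; apply: DA.
(* Multiplication by [a] embeds the zero divisors of [B - B] into those of [A - A]; then [2 <= n]
   and [553 <= n] absorb [2 * K ^+ 553]. *)
- rewrite cB; move: 553%N n553 => p pn; apply: (@le_trans _ _
    (2 * K ^+ p * (n%:R^-1 * (K ^+ n)^-1 * #|` A|%:R))).
    rewrite ler_wpM2l ?mulr_ge0 ?exprn_ge0 //; apply: le_trans (ltW hZ).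
    rewrite ler_nat -(card_inj_imfset (zero_divisors_in _) aI).
    apply/fsubset_leq_card/fsubsetP => _ /imfsetP[z /= + ->].
    rewrite !inE => /andP[/imfset2P[x /= xB [y /= yB ->]] /asboolP nd].
    apply/andP; split.
      by rewrite mulrBr; apply: in_imfset2; apply: BA.
    (* If [a z] is not a zero divisor, neither is [z]: on the right use [a z u], on the left
       [u z = (u a') (a z)]. *)
    apply/asboolP => H; apply: nd => u u0; split.
      have [au _] := H u u0; apply: contraNneq au => e.
      by rewrite -mulrA e mulr0.
    have ua0 : u * a' != 0.
      apply: contraNneq u0 => e; rewrite -[u]mulr1 -a'a mulrA e mul0r //.
    have [_] := H _ ua0; by rewrite mulrA -[u * a' * a]mulrA a'a mulr1.
  rewrite mulrA ler_piMl //.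
  have -> : 2 * K ^+ p * (n%:R^-1 * (K ^+ n)^-1) =
      (2 * n%:R^-1) * (K ^+ p / K ^+ n) by rewrite mulrACA.
  rewrite mulr_ile1 ?divr_ge0 ?mulr_ge0 ?invr_ge0 ?exprn_ge0 //.
    by rewrite ler_pdivrMr ?ltr0n // mul1r ler_nat.
  by rewrite ler_pdivrMr ?exprn_gt0 // mul1r ler_weXn2l.
exists S; split => //.
- apply/fsubsetP => x xA; rewrite -[x]mul1r -aa' -mulrA mem_ldilate //.
  by apply: (fsubsetP BS); apply: mem_ldilate.
- apply/fsetP => z; apply/imfsetP/imfsetP => /= -[s sS ->].
    by exists (a * s * a'); [exact: s2|rewrite -mulrA a'a mulr1].
  by exists (a' * s * a); [exact: s1|rewrite !mulrA aa' mul1r].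
- apply: le_trans cS _; rewrite cB ler_wpM2r //.
  have {n553}: (294 <= n)%N by apply: leq_trans n553.
  by move: 294%N => q qn; rewrite ler_pM ?exprn_ge0 ?ler_nat // ler_weXn2l.
Qed.
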